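(* The infinite sequence $\{(-1)^n n!\,b_{n+1}\}_{n\ge0}$, where $b_n$ are the Bernoulli numbers of the second kind, is logarithmically convex.
   Context: The Bernoulli numbers of the second kind $b_n$, $n\ge 0$, are the real numbers defined by the power series expansion (around $x=0$) $\frac{x}{\ln(1+x)}=\sum_{n=0}^\infty b_nx^n$, where the left-hand side is given its limit value $1$ at $x=0$. A sequence $\{x_n\}_{n\ge0}$ of nonnegative real numbers is logarithmically convex if $x_n x_{n+2}\ge x_{n+1}^2$ for all $n\ge0$. *)

(* Defs.v *)
From Stdlib Require Import Reals Factorial.
From Coquelicot Require Import Coquelicot.
Open Scope R_scope.

(* Only the values near 0 matter: Stdlib's [ln] is 0 on nonpositive reals, so
   for x <= -1 this is a division by 0 of no significance. *)
Definition bernoulli2_gf (x : R) : R :=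
  if Req_EM_T x 0 then 1 else x / ln (1 + x).

(* The power series with coefficients [b] converges to the generating function
   on some neighbourhood of 0; this determines [b] uniquely. *)
Definition is_bernoulli2 (b : nat -> R) : Prop :=
  locally 0 (fun x : R => is_pseries b x (bernoulli2_gf x)).

(* Nonnegativity is part of the notion. *)
Definition log_convex (x : nat -> R) : Prop :=
  (forall n : nat, 0 <= x n) /\
  (forall n : nat, x n * x (n + 2)%nat >= x (n + 1)%nat ^ 2).

(* Main.v *)
Require Import Defs.
From Stdlib Require Import Reals Factorial Lra Lia.
From Coquelicot Require Import Coquelicot.
Open Scope R_scope.

(** Since [x / ln (1 + x)] is the integral of [(1 + x) ^ t] over [t] in [0, 1],
    differentiating [n + 1] times at [x = 0] shows that [(n + 1)! b_{n+1}] is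
    the integral of [t (t - 1) ... (t - n)].  Hence [(-1)^n n! b_{n+1}] is
    [a_n / (n + 1)] with [a_n] the integral of [w_n = t (1 - t) ... (n - t)],
    which is nonnegative.  With [y = n + 1 - t] we have [w_{n+1} = y w_n] and
    [w_{n+2} = (y^2 + y) w_n], so Cauchy-Schwarz for the weight [w_n] makes
    [a_n] log-convex, and so is [1 / (n + 1)]. *)

Fixpoint falling (n : nat) (t : R) : R :=
  match n with
  | O => 1
  | S m => falling m t * (t - INR m)
  end.

(** Closed form of the [n]-th derivative of the generating function on [-1 < x], so that all
    derivatives follow by one induction on [n]. *)
Definition gf_deriv (n : nat) (x : R) : R :=
  RInt (fun t => falling n t * Rpower (1 + x) (t - INR n)) 0 1.

Lemma continuous_falling (n : nat) (t : R) : continuous (falling n) t.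
Proof.
induction n as [|n IH]; simpl.
- apply continuous_const.
- apply (continuous_mult (K := R_AbsRing)); [exact IH|].
  apply (ex_derive_continuous (fun t => t - INR n)); auto_derive; auto.
Qed.

Lemma continuous_falling_Rpower (n : nat) (x t : R) :
  continuous (fun t => falling n t * Rpower (1 + x) (t - INR n)) t.
Proof.
apply (continuous_mult (K := R_AbsRing)); [apply continuous_falling|].
apply (ex_derive_continuous (fun t => Rpower (1 + x) (t - INR n))).
unfold Rpower; auto_derive; auto.
Qed.

Lemma is_derive_falling_Rpower (n : nat) (t x : R) : -1 < x ->
  is_derive (fun x => falling n t * Rpower (1 + x) (t - INR n)) x
    (falling (S n) t * Rpower (1 + x) (t - INR (S n))).
Proof.
intros Hx.
(* Differentiating [exp] of a multiple of [ln (1 + x)] produces a factor [/ (1 + x)], which lowers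
   the exponent by one. *)
replace (Rpower (1 + x) (t - INR (S n)))
  with (Rpower (1 + x) (t - INR n) * / (1 + x)).
- unfold Rpower; auto_derive; [lra|]; simpl; field; lra.
- rewrite S_INR.
  replace (t - (INR n + 1)) with (t - INR n + - (1)) by ring.
  rewrite Rpower_plus, Rpower_Ropp, Rpower_1; lra.
Qed.

Lemma locally_gt (a x : R) : a < x -> locally x (fun y => a < y).
Proof. exact (open_gt a x). Qed.

Lemma continuity_2d_falling_Rpower (n : nat) (x t : R) : -1 < x ->
  continuity_2d_pt
    (fun u v => falling n v * Rpower (1 + u) (v - INR n)) x t.
Proof.
intros Hx.
apply continuity_2d_pt_mult.
- apply (continuity_1d_2d_pt_comp (falling n) (fun _ v => v)).
  + apply continuity_pt_filterlim, continuous_falling.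
  + apply continuity_2d_pt_id2.
- unfold Rpower.
  apply (continuity_1d_2d_pt_comp exp
           (fun u v => (v - INR n) * ln (1 + u))).
  + apply derivable_continuous_pt, derivable_pt_exp.
  + apply continuity_2d_pt_mult.
    * apply continuity_2d_pt_minus;
        [apply continuity_2d_pt_id2 | apply continuity_2d_pt_const].
    * apply (continuity_1d_2d_pt_comp (fun u => ln (1 + u)) (fun u _ => u)).
      -- apply continuity_pt_filterlim.
         apply (ex_derive_continuous (fun u => ln (1 + u))).
         auto_derive; lra.
      -- apply continuity_2d_pt_id1.
Qed.

(** Differentiation under the integral sign, justified by the joint continuity of the partial
    derivative in [x]. *)
Lemma is_derive_gf_deriv (n : nat) (x : R) : -1 < x ->
  is_derive (gf_deriv n) x (gf_deriv (S n) x).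
Proof.
intros Hx.
replace (gf_deriv (S n) x) with
  (RInt (fun t =>
     Derive (fun u => falling n t * Rpower (1 + u) (t - INR n)) x) 0 1).
- apply (is_derive_RInt_param
           (fun u t => falling n t * Rpower (1 + u) (t - INR n))).
  + apply (filter_imp (fun y => -1 < y)); [|now apply locally_gt].
    intros y Hy t _; eexists; now apply is_derive_falling_Rpower.
  + intros t _.
    (* The closed form of the partial derivative is known only for [-1 < u], hence the local
       extensionality. *)
    apply continuity_2d_pt_ext_loc with
      (fun u v => falling (S n) v * Rpower (1 + u) (v - INR (S n))).
    * destruct (locally_gt (-1) x Hx) as [e He].
      exists e; intros u v Hu _.
      symmetry; apply is_derive_unique, is_derive_falling_Rpower.
      now apply He.
    * now apply continuity_2d_falling_Rpower.
  + apply filter_forall; intros y.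
    apply (ex_RInt_continuous (V := R_CompleteNormedModule)); intros t _.
    apply continuous_falling_Rpower.
- apply RInt_ext; intros t _.
  now apply is_derive_unique, is_derive_falling_Rpower.
Qed.

Lemma Derive_n_gf_deriv (n : nat) (x : R) : -1 < x ->
  Derive_n (gf_deriv 0) n x = gf_deriv n x.
Proof.
revert x; induction n as [|n IH]; intros x Hx; [reflexivity|]; simpl.
rewrite (Derive_ext_loc _ (gf_deriv n)).
- now apply is_derive_unique, is_derive_gf_deriv.
- apply (filter_imp (fun y => -1 < y)); [|now apply locally_gt].
  exact IH.
Qed.

(** For [x <> 0], an antiderivative of [(1 + x) ^ t] in [t] is [(1 + x) ^ t / ln (1 + x)]; for
    [x = 0] the integrand is constantly 1. *)
Lemma gf_deriv_0 (x : R) : -1 < x -> gf_deriv 0 x = bernoulli2_gf x.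
Proof.
intros Hx; unfold gf_deriv, bernoulli2_gf, Rpower; simpl.
destruct (Req_EM_T x 0) as [->|Hx0].
- rewrite (RInt_ext _ (fun _ => 1)).
  + rewrite RInt_const; unfold scal; simpl; unfold mult; simpl; ring.
  + intros t _.
    now rewrite Rplus_0_r, ln_1, Rmult_0_r, exp_0, Rmult_1_r.
- assert (HL : ln (1 + x) <> 0).
  { intros H; apply Hx0.
    assert (1 + x = 1) by (apply ln_inv; [lra|lra|now rewrite ln_1]); lra. }
  apply is_RInt_unique.
  replace (x / ln (1 + x)) with
    (minus (exp (1 * ln (1 + x)) / ln (1 + x))
           (exp (0 * ln (1 + x)) / ln (1 + x))).
  + apply (is_RInt_derive (fun t => exp (t * ln (1 + x)) / ln (1 + x))).
    * intros t _; auto_derive; [auto|]; rewrite Rminus_0_r; now field.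
    * intros t _.
      apply (ex_derive_continuous (fun t => 1 * exp ((t - 0) * ln (1 + x)))).
      auto_derive; auto.
  + rewrite Rmult_1_l, Rmult_0_l, exp_0, exp_ln by lra.
    unfold minus, plus, opp; simpl; now field.
Qed.

(** If the radius were below [e / 2], the terms at [e / 2] could not tend to 0, although the series
    converges there. *)
Lemma CV_radius_pos_of_locally (b : nat -> R) (f : R -> R) :
  locally 0 (fun x => is_pseries b x (f x)) -> Rbar_lt 0 (CV_radius b).
Proof.
intros [e He].
assert (Hpos := cond_pos e).
apply Rbar_lt_le_trans with (Finite (e / 2)); [simpl; lra|].
rewrite <- (Rabs_pos_eq (e / 2)) by lra.
apply Rbar_not_lt_le; intros Hlt.
apply (CV_disk_outside b (e / 2)); [exact Hlt|].
apply ex_series_lim_0.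
apply ex_pseries_R.
exists (f (e / 2)); apply He.
unfold ball; simpl; unfold AbsRing_ball, abs, minus, plus, opp; simpl.
rewrite Rabs_pos_eq; lra.
Qed.

(** Both sides are the [n]-th derivative of the generating function at 0, where the power of [1 + x]
    in [gf_deriv] is 1. *)
Lemma bernoulli2_RInt (b : nat -> R) (n : nat) : is_bernoulli2 b ->
  b n * INR (fact n) = RInt (falling n) 0 1.
Proof.
intros hb.
rewrite <- Derive_n_coef by exact (CV_radius_pos_of_locally _ _ hb).
rewrite (Derive_n_ext_loc _ (gf_deriv 0)).
- rewrite Derive_n_gf_deriv by lra.
  apply RInt_ext; intros t _.
  unfold Rpower; now rewrite Rplus_0_r, ln_1, Rmult_0_r, exp_0, Rmult_1_r.
- apply (filter_imp (fun y => is_pseries b y (bernoulli2_gf y) /\ -1 < y)).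
  + intros y [Hy Hy1].
    rewrite gf_deriv_0 by exact Hy1.
    now apply is_pseries_unique.
  + apply filter_and; [exact hb|apply locally_gt; lra].
Qed.

(** This is [t (1 - t) ... (n - t)]: the sign flips every factor of [falling (S n)] except [t]. *)
Definition weight (n : nat) (t : R) : R := (-1) ^ n * falling (S n) t.

Lemma weight_S (n : nat) (t : R) : weight (S n) t = (INR (S n) - t) * weight n t.
Proof. unfold weight; cbn [falling pow]; ring. Qed.

Lemma weight_ge0 (n : nat) (t : R) : 0 <= t <= 1 -> 0 <= weight n t.
Proof.
intros Ht; induction n as [|n IH].
- unfold weight; simpl; lra.
- rewrite weight_S; apply Rmult_le_pos; [|exact IH].
  rewrite S_INR; assert (H := pos_INR n); lra.
Qed.

Lemma ex_RInt_falling (n : nat) (a b : R) : ex_RInt (falling n) a b.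
Proof.
apply (ex_RInt_continuous (V := R_CompleteNormedModule)); intros t _.
apply continuous_falling.
Qed.

Lemma ex_RInt_weight (n : nat) (a b : R) : ex_RInt (weight n) a b.
Proof. exact (ex_RInt_scal _ a b ((-1) ^ n) (ex_RInt_falling (S n) a b)). Qed.

Lemma RInt_weight_ge0 (n : nat) : 0 <= RInt (weight n) 0 1.
Proof.
apply RInt_ge_0; [lra|apply ex_RInt_weight|].
intros t Ht; apply weight_ge0; lra.
Qed.

(** If [C] is nonzero, evaluate the quadratic at its minimum [l = B / C]. *)
Lemma discriminant_le (A B C : R) : 0 <= C ->
  (forall l, 0 <= A - 2 * l * B + l ^ 2 * C) -> B ^ 2 <= A * C.
Proof.
intros HC H.
destruct (Req_dec C 0) as [->|HC0].
- destruct (Req_dec B 0) as [->|HB]; [lra|].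
  (* With [C = 0] the expression is affine in [l]; this [l] gives it the value -1. *)
  assert (H1 := H ((A + 1) / (2 * B))).
  replace (A - 2 * ((A + 1) / (2 * B)) * B + ((A + 1) / (2 * B)) ^ 2 * 0)
    with (-1) in H1 by (field; exact HB).
  lra.
- assert (H1 := H (B / C)).
  replace (A - 2 * (B / C) * B + (B / C) ^ 2 * C)
    with ((A * C - B ^ 2) / C) in H1 by (field; exact HC0).
  assert (H2 := Rmult_le_pos _ _ H1 HC).
  replace ((A * C - B ^ 2) / C * C) with (A * C - B ^ 2) in H2
    by (field; exact HC0).
  lra.
Qed.

(** With [y = n + 1 - t], the quadratic in [l] is the integral of [((y - l) ^ 2 + y) * weight n t],
    which is nonnegative since [y >= 0] on [0, 1]. *)
Lemma RInt_weight_log_convex (n : nat) :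
  RInt (weight (S n)) 0 1 ^ 2
    <= RInt (weight (S (S n))) 0 1 * RInt (weight n) 0 1.
Proof.
apply discriminant_le; [apply RInt_weight_ge0|]; intros l.
assert (Hi : forall m, is_RInt (weight m) 0 1 (RInt (weight m) 0 1)).
{ intros m; apply (RInt_correct (V := R_CompleteNormedModule)).
  apply ex_RInt_weight. }
assert (HI := is_RInt_plus _ _ _ _ _ _
  (is_RInt_minus _ _ _ _ _ _ (Hi (S (S n)))
     (is_RInt_scal _ _ _ (2 * l) _ (Hi (S n))))
  (is_RInt_scal _ _ _ (l ^ 2) _ (Hi n))).
unfold minus, plus, opp, scal in HI; simpl in HI; unfold mult in HI;
  cbn -[INR weight pow] in HI.
refine (is_RInt_le (fun _ => 0) _ 0 1 0 _ Rle_0_1 _ HI _).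
- assert (H0 := is_RInt_const (V := R_NormedModule) 0 1 0).
  unfold scal in H0; simpl in H0; unfold mult in H0; simpl in H0.
  now rewrite Rmult_0_r in H0.
- intros t Ht.
  rewrite !weight_S, !S_INR.
  assert (Hw : 0 <= weight n t) by (apply weight_ge0; lra).
  assert (Hn := pos_INR n).
  replace (_ + _) with
    (((INR n + 1 - t - l) ^ 2 + (INR n + 1 - t)) * weight n t) by ring.
  apply Rmult_le_pos; [|exact Hw].
  assert (H := pow2_ge_0 (INR n + 1 - t - l)); lra.
Qed.

Lemma bernoulli2_RInt_weight (b : nat -> R) (n : nat) : is_bernoulli2 b ->
  (-1) ^ n * INR (fact n) * b (n + 1)%nat = RInt (weight n) 0 1 / (INR n + 1).
Proof.
intros hb.
assert (Hn := pos_INR n).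
replace (RInt (weight n) 0 1) with ((-1) ^ n * RInt (falling (S n)) 0 1).
- rewrite <- (bernoulli2_RInt b (S n) hb), Nat.add_1_r, fact_simpl, mult_INR,
    S_INR.
  field; lra.
- symmetry.
  exact (RInt_scal (V := R_CompleteNormedModule) _ 0 1 ((-1) ^ n)
           (ex_RInt_falling (S n) 0 1)).
Qed.

Theorem corollary1p1 (b : nat -> R) (hb : is_bernoulli2 b) :
  log_convex (fun n : nat => (-1) ^ n * INR (fact n) * b (n + 1)%nat).
Proof.
split; intros n; assert (Hn := pos_INR n).
- rewrite (bernoulli2_RInt_weight b n hb).
  apply Rdiv_le_0_compat; [apply RInt_weight_ge0|lra].
- rewrite !(bernoulli2_RInt_weight b _ hb), !plus_INR; simpl INR.
  rewrite Nat.add_1_r; replace (n + 2)%nat with (S (S n)) by lia.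
  assert (Hc := RInt_weight_log_convex n).
  set (A := RInt (weight (S (S n))) 0 1) in *.
  set (B := RInt (weight (S n)) 0 1) in *.
  set (C := RInt (weight n) 0 1) in *.
  apply Rle_ge.
  (* The first inequality is [(n + 1) (n + 3) <= (n + 2) ^ 2], the log-convexity of [1 / (n + 1)];
     the second is that of the integrals. *)
  apply Rle_trans with (B ^ 2 / ((INR n + 1) * (INR n + 3))).
  + replace ((B / (INR n + 1 + 1)) ^ 2) with (B ^ 2 / (INR n + 2) ^ 2)
      by (field; lra).
    apply Rmult_le_compat_l; [apply pow2_ge_0|].
    apply Rinv_le_contravar; nra.
  + replace (C / (INR n + 1) * (A / (INR n + (1 + 1) + 1)))
      with (A * C / ((INR n + 1) * (INR n + 3))) by (field; lra).
    apply Rmult_le_compat_r; [|exact Hc].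
    apply Rlt_le, Rinv_0_lt_compat; nra.
Qed.
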